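(* Let $m,n$ be integers with $0<m\le n$. Then the total partition function $Z'_{\mathrm{tot}}(C_{m,n};-q,Q)$ is homogeneous of degree $$d=\frac{(m^2-m+n^2-n-2mn)\,(m+n-2)!}{m!\,n!},$$ namely, $$Z'_{\mathrm{tot}}(C_{m,n};-q,Q)=\prod_{1\le i\le j\le m+n-1}M(Q_{ij},q)^{d}.$$
   Context: $C_{m,n}=\{(x,y,z,w)\in\mathbb{C}^4: xy-z^mw^n=0\}$ is the toric variety whose toric data is the lattice trapezoid with vertices $(0,0),(0,1),(m,1),(n,0)$. **Triangulations.** Crepant resolutions of $C_{m,n}$ correspond to maximal lattice triangulations of this trapezoid (all triangles of area $1/2$). Each triangle has exactly one horizontal side, its base, on the top line (height $1$) or the bottom line (height $0$). The triangles are numbered $t_1,\dots,t_{m+n}$ from left to right, $t_1$ containing the side $(0,0)$--$(0,1)$ and $t_{m+n}$ the side $(m,1)$--$(n,0)$. A triangulation is recorded by the subset $T\subset\{1,\dots,m+n\}$, $|T|=m$, of indices $k$ such that $t_k$ has its base on the top line; every such subset occurs. The interior edges are $e_i=t_i\cap t_{i+1}$, $1\le i\le m+n-1$. Put $\tau_T(e_i)=+1$ if $t_i,t_{i+1}$ have their bases on the same line (that is, $i,i+1$ are both in $T$ or both not in $T$) and $\tau_T(e_i)=-1$ otherwise. **Partition functions.** $Q=(Q_1,\dots,Q_{m+n-1})$ are formal variables, $Q_i$ corresponding to the edge $e_i$ in every triangulation, and $Q_{ij}=Q_iQ_{i+1}\cdots Q_j$ for $i\le j$. The (generalised) MacMahon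 function is $M(x,q)=\prod_{k\ge1}(1-xq^k)^{-k}$. The reduced Donaldson--Thomas partition function of the resolution given by $T$ is $$Z'_T(C_{m,n};-q,Q)=\prod_{1\le i\le j\le m+n-1}M(Q_{ij},q)^{\tau_T(e_i)\tau_T(e_{i+1})\cdots\tau_T(e_j)},$$ and the total partition function is $$Z'_{\mathrm{tot}}(C_{m,n};-q,Q)=\prod_{T\subset\{1,\dots,m+n\},\ |T|=m}Z'_T(C_{m,n};-q,Q).$$ **Homogeneity.** A partition function $Z(q,Q)$ is homogeneous of degree $d$ if $Z(q,Q)=\bigl(\prod_A M(\prod_{i\in A}Q_i,q)\bigr)^d$, the product over $A$ running over some finite collection of index sets $A\subset\{1,2,\dots\}$. *)

(* Defs.v *)
From HB Require Import structures.
From mathcomp Require Import all_boot all_order all_algebra.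
From mathcomp Require Import mpoly boolp.

Set Implicit Arguments.
Unset Strict Implicit.
Unset Printing Implicit Defensive.

Import GRing.Theory Num.Theory.

Local Open Scope ring_scope.

(* Formal power series in n variables over R, as coefficient functions on
   monomials: the ring R[[X_0, ..., X_(n-1)]].  Products, inverses and the
   MacMahon function only ever involve finitely many coefficients at a given
   monomial, so no topology is needed. *)
Record mseries (R : Type) (n : nat) := MSeries { mscoef :> 'X_{1..n} -> R }.

HB.instance Definition _ (R : Type) n := gen_eqMixin (mseries R n).
HB.instance Definition _ (R : Type) n := gen_choiceMixin (mseries R n).

Lemma mseriesP (R : Type) n (f g : mseries R n) : f =1 g -> f = g.
Proof. by case: f g => [f] [g] /= fg; congr MSeries; apply/funext. Qed.

Section Ring.
Variables (R : comNzRingType) (n : nat).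
Implicit Types (f g h : mseries R n) (m : 'X_{1..n}) (d : nat).

Definition ms0 : mseries R n := MSeries (fun=> 0).
Definition msopp f : mseries R n := MSeries (fun m => - f m).
Definition msadd f g : mseries R n := MSeries (fun m => f m + g m).
Definition msC (c : R) : mseries R n := MSeries (fun m => c *+ (m == 0%MM)).
(* Cauchy product; the degree bound merely makes the index type finite. *)
Definition msmul f g : mseries R n := MSeries (fun m =>
  \sum_(k : 'X_{1..n < (mdeg m).+1} | (k <= m)%MM) f k * g (m - k)%MM).

Fact msaddA : associative msadd.
Proof. by move=> f g h; apply/mseriesP => m /=; rewrite addrA. Qed.
Fact msaddC : commutative msadd.
Proof. by move=> f g; apply/mseriesP => m /=; rewrite addrC. Qed.
Fact msadd0 : left_id ms0 msadd.
Proof. by move=> f; apply/mseriesP => m /=; rewrite add0r. Qed.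
Fact msaddN : left_inverse ms0 msopp msadd.
Proof. by move=> f; apply/mseriesP => m /=; rewrite addNr. Qed.
HB.instance Definition _ :=
  GRing.isZmodule.Build (mseries R n) msaddA msaddC msadd0 msaddN.

(* Truncation to polynomials, used to transfer the ring axioms. *)
Definition mstrunc d f : {mpoly R[n]} :=
  \sum_(m : 'X_{1..n < d.+1}) f m *: 'X_[m].

Lemma mcoeff_mstrunc d f m : (mdeg m <= d)%N -> (mstrunc d f)@_m = f m.
Proof. by move=> md; rewrite mcoeff_mpoly. Qed.

Lemma msmul_mpoly d f g m (p q : {mpoly R[n]}) : (mdeg m <= d)%N ->
  (forall k, (mdeg k <= d)%N -> p@_k = f k) ->
  (forall k, (mdeg k <= d)%N -> q@_k = g k) ->
  msmul f g m = (p * q)@_m.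
Proof.
move=> md pf qg; rewrite (mcoeff_poly_mul_lin _ _ (ltnSn (mdeg m))) /=.
apply: eq_bigr => k km; rewrite pf ?qg //.
  by rewrite (leq_trans _ md)// mdegB.
by rewrite (leq_trans _ md)// -ltnS bmdeg.
Qed.

Lemma msmulE d f g m : (mdeg m <= d)%N ->
  msmul f g m = (mstrunc d f * mstrunc d g)@_m.
Proof. by move=> md; apply: msmul_mpoly md _ _ => k kd; rewrite mcoeff_mstrunc. Qed.

Fact msmulA : associative msmul.
Proof.
move=> f g h; apply/mseriesP => m; pose d := mdeg m.
rewrite (@msmul_mpoly d _ _ _ (mstrunc d f) (mstrunc d g * mstrunc d h)) //;
  [|by move=> k kd; rewrite mcoeff_mstrunc|by move=> k kd; rewrite -msmulE].
rewrite mulrA; symmetry; apply: (@msmul_mpoly d) => // k kd.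
  by rewrite -msmulE.
by rewrite mcoeff_mstrunc.
Qed.
Fact msmulC : commutative msmul.
Proof.
by move=> f g; apply/mseriesP => m; rewrite !(msmulE _ _ (leqnn _)) mulrC.
Qed.
Fact msmul1 : left_id (msC 1) msmul.
Proof.
move=> f; apply/mseriesP => m; pose d := mdeg m.
rewrite (@msmul_mpoly d _ _ _ 1 (mstrunc d f)) ?mul1r ?mcoeff_mstrunc //.
  by move=> k _; rewrite mcoeff1.
by move=> k kd; rewrite mcoeff_mstrunc.
Qed.
Fact msmulDl : left_distributive msmul msadd.
Proof.
move=> f g h; apply/mseriesP => m; rewrite /= -big_split /=.
by apply: eq_bigr => k _; rewrite mulrDl.
Qed.
Fact ms1_neq0 : msC 1 != ms0.
Proof.
apply/eqP => /(congr1 (fun f : mseries R n => f 0%MM)) /= /eqP.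
by rewrite eqxx oner_eq0.
Qed.
HB.instance Definition _ := GRing.Zmodule_isComNzRing.Build (mseries R n)
  msmulA msmulC msmul1 msmulDl ms1_neq0.

Lemma mscoef0 m : (0 : mseries R n) m = 0. Proof. by []. Qed.
Lemma mscoef1 m : (1 : mseries R n) m = (m == 0%MM)%:R. Proof. by []. Qed.
Lemma mscoefC c m : msC c m = c *+ (m == 0%MM). Proof. by []. Qed.
Lemma mscoefD f g m : (f + g) m = f m + g m. Proof. by []. Qed.
Lemma mscoefN f m : (- f) m = - f m. Proof. by []. Qed.
Lemma mscoefM f g m : (f * g) m =
  \sum_(k : 'X_{1..n < (mdeg m).+1} | (k <= m)%MM) f k * g (m - k)%MM.
Proof. by []. Qed.

Lemma mscoefM0 f g : (f * g) 0%MM = f 0%MM * g 0%MM.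
Proof.
have -> : (f * g) 0%MM = msmul f g 0%MM by [].
by rewrite (msmulE _ _ (leqnn _)) rmorphM /= !mcoeff_mstrunc.
Qed.

(* Equality of coefficients up to total degree d. *)
Definition mseqd d f g := forall m, (mdeg m <= d)%N -> f m = g m.

Lemma mseqdM d f f' g g' :
  mseqd d f f' -> mseqd d g g' -> mseqd d (f * g) (f' * g').
Proof.
move=> ff gg m md; rewrite !mscoefM; apply: eq_bigr => k km.
rewrite ff ?gg //; first by rewrite (leq_trans _ md)// mdegB.
by rewrite (leq_trans _ md)// -ltnS bmdeg.
Qed.

(* Series whose terms of total degree < d vanish. *)
Definition msord d f := forall m, (mdeg m < d)%N -> f m = 0.

Lemma msordM a b f g : msord a f -> msord b g -> msord (a + b) (f * g).
Proof.
move=> fa gb m md; rewrite mscoefM big1 // => k km.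
have [ka|ka] := ltnP (mdeg k) a; first by rewrite fa ?mul0r.
rewrite gb ?mulr0 //.
rewrite -(ltn_add2l a); apply: leq_ltn_trans md.
apply: leq_trans (leq_add ka (leqnn _)) _.
by rewrite -mdegD addmC submK.
Qed.

Lemma msordX f k : f 0%MM = 0 -> msord k (f ^+ k).
Proof.
move=> f0; elim: k => [|k IH] //; rewrite exprS -add1n; apply: msordM IH.
by move=> m; rewrite ltnS leqn0 mdeg_eq0 => /eqP ->.
Qed.

End Ring.

Section UnitRing.
Variables (R : comUnitRingType) (n : nat).
Implicit Types (f g h u x q : mseries R n) (m : 'X_{1..n}) (d : nat).

(* 1 + u + u^2 + ..., for u without constant term. *)
Definition msgeom u : mseries R n :=
  MSeries (fun m => (\sum_(k < (mdeg m).+1) u ^+ k) m).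

Lemma mscoef_sum (I : Type) (r : seq I) (P : pred I) (F : I -> mseries R n) m :
  (\sum_(i <- r | P i) F i) m = \sum_(i <- r | P i) F i m.
Proof. by elim/big_rec2: _ => // i y x _ <-. Qed.

Lemma msgeomE u d : u 0%MM = 0 ->
  mseqd d (msgeom u) (\sum_(k < d.+1) u ^+ k).
Proof.
move=> u0 m md; rewrite /= !mscoef_sum.
rewrite -(big_mkord xpredT (fun k => (u ^+ k) m)).
rewrite -(big_mkord xpredT (fun k => (u ^+ k) m)).
rewrite [RHS](@big_cat_nat _ _ _ (mdeg m).+1) //= [X in _ + X]big_nat.
by rewrite [X in _ + X]big1 ?addr0 // => k /andP[km _]; apply: msordX.
Qed.

Lemma msgeomP u : u 0%MM = 0 -> (1 - u) * msgeom u = 1.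
Proof.
move=> u0; apply/mseriesP => m.
rewrite (mseqdM (fun _ _ => erefl) (msgeomE u0) (leqnn (mdeg m))).
rewrite -[1 - u]opprB mulNr -subrX1 opprB mscoefD mscoefN.
by rewrite (msordX u0 (ltnSn _)) subr0.
Qed.

Definition msunit : pred (mseries R n) := fun f => f 0%MM \is a GRing.unit.

Definition msinv f : mseries R n :=
  if msunit f then msC n (f 0%MM)^-1 * msgeom (1 - msC n (f 0%MM)^-1 * f) else f.

Fact msmulV : {in msunit, left_inverse 1 msinv *%R}.
Proof.
move=> f uf; rewrite /msinv; move: (uf); rewrite -topredE /= => ->.
set c := msC _ _; set u := 1 - c * f.
rewrite mulrAC mulrC [c * f](_ : _ = 1 - u); last by rewrite /u subKr.
rewrite mulrC msgeomP // mscoefD mscoefN mscoefM0 mscoef1 mscoefC eqxx mulr1n.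
by rewrite mulVr ?subrr.
Qed.

Fact msunitP f g : g * f = 1 -> msunit f.
Proof.
move=> /(congr1 (fun h : mseries R n => h 0%MM)).
rewrite mscoefM0 mscoef1 eqxx => gf; apply/unitrPr; exists (g 0%MM).
by rewrite mulrC.
Qed.

Fact msinv_out : {in [predC msunit], msinv =1 id}.
Proof. by move=> f; rewrite inE /= /msinv => /negbTE; rewrite -topredE /= => ->. Qed.

HB.instance Definition _ :=
  GRing.ComNzRing_hasMulInverse.Build (mseries R n) msmulV msunitP msinv_out.

Lemma msunitE f : (f \is a GRing.unit) = (f 0%MM \is a GRing.unit).
Proof. by []. Qed.

Lemma mseqdV d f g : f \is a GRing.unit -> g \is a GRing.unit ->
  mseqd d f g -> mseqd d f^-1 g^-1.
Proof.
move=> uf ug fg.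
rewrite -[f^-1]mulr1 -[1](divrr ug) -[X in mseqd _ _ X]mul1r -[1 in X in mseqd _ _ X](mulVr uf).
rewrite mulrA; apply: mseqdM => //; apply: mseqdM => // m md.
by rewrite fg.
Qed.

Definition msX (i : 'I_n) : mseries R n := MSeries (fun m => (m == U_(i)%MM)%:R).

(* The factors with k > mdeg m do not contribute to the coefficient at m; see
   MacMahonP below. *)
Definition MacMahon (x q : mseries R n) : mseries R n := MSeries (fun m =>
  (\prod_(1 <= k < (mdeg m).+1) (1 - x * q ^+ k) ^- k) m).

Lemma MacMahonP x q : q 0%MM = 0 -> forall m K, (mdeg m <= K)%N ->
  (\prod_(1 <= k < K.+1) (1 - x * q ^+ k) ^- k) m = MacMahon x q m.
Proof.
move=> q0 m K mK; rewrite (@big_cat_nat _ _ _ (mdeg m).+1) //=.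
set P := \prod_(_ <= _ < K.+1) _; rewrite -[in RHS](mulr1 (\prod_(_ <= _ < _) _)).
apply: (@mseqdM _ _ (mdeg m)) => //; rewrite {}/P big_nat.
apply: (big_ind (fun f => mseqd (mdeg m) f 1)) => [//|f g f1 g1|k /andP[mk _]].
  by rewrite -[1]mulr1; apply: mseqdM.
have k0 : (0 < k)%N by apply: leq_trans mk.
have u0 : (1 - x * q ^+ k) 0%MM = 1.
  rewrite mscoefD mscoefN mscoefM0 mscoef1 eqxx.
  by rewrite (msordX q0) ?mdeg0// mulr0 subr0.
have uu : 1 - x * q ^+ k \is a GRing.unit by rewrite msunitE u0 unitr1.
rewrite -[1 in X in mseqd _ _ X]invr1; apply: mseqdV; rewrite ?unitrX ?unitr1//.
elim: {2}k => [//|j IH]; rewrite exprS -[X in mseqd _ _ X]mulr1.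
apply: mseqdM => // l ld; rewrite mscoefD mscoefN.
rewrite (@msordM _ _ 0 k x) ?subr0 //; first exact: msordX.
exact: leq_ltn_trans ld _.
Qed.

Lemma MacMahon_unit x q : q 0%MM = 0 -> MacMahon x q \is a GRing.unit.
Proof.
by move=> q0; rewrite msunitE /= mdeg0 big_geq // mscoef1 eqxx unitr1.
Qed.

End UnitRing.

Section PartitionFunctions.
Variables (m n : nat).

(* Formal power series in q = X_0 and Q_i = X_i for 1 <= i <= m + n - 1. *)
Definition pseries := mseries int (m + n).-1.+1.

Definition qvar : pseries := msX int ord0.
Definition Qvar (i : nat) : pseries := msX int (inord i).
Definition Qprod (i j : nat) : pseries := \prod_(i <= k < j.+1) Qvar k.

(* A maximal triangulation of the trapezoid is recorded by the set of indices
   of the triangles with base on the top line; ordinal 0 is never used, so that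
   these indices run from 1 to m + n. *)
Definition triangulations : {set {set 'I_(m + n).+1}} :=
  [set T : {set 'I_(m + n).+1} | (ord0 \notin T) && (#|T| == m)].

Definition tau (T : {set 'I_(m + n).+1}) (i : nat) : int :=
  if (inord i \in T) == (inord i.+1 \in T) then 1 else -1.

(* As functions of the first argument p of Z'(p, Q); the MacMahon factors of
   Z'(-q, Q) are in q, hence the sign. *)
Definition ZT (T : {set 'I_(m + n).+1}) (p : pseries) : pseries :=
  \prod_(1 <= i < m + n) \prod_(i <= j < m + n)
    MacMahon (Qprod i j) (- p) ^ (\prod_(i <= k < j.+1) tau T k).

Definition Ztot (p : pseries) : pseries := \prod_(T in triangulations) ZT T p.

(* The collection C of index sets consists of subsets of {1, ..., m + n - 1}. *)
Definition homogeneous_of_degree (Z : pseries) (d : int) : Prop :=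
  exists2 C : {set {set 'I_(m + n).-1.+1}},
    (forall A, A \in C -> ord0 \notin A) &
    Z = (\prod_(A in C) MacMahon (\prod_(i in A) Qvar i) qvar) ^ d.

End PartitionFunctions.

(* Main.v *)
Require Import Defs.
From mathcomp Require Import all_boot all_order all_algebra.
From mathcomp Require Import zify ring.
From mathcomp Require mpoly.

Import GRing.Theory Num.Theory.

Local Open Scope ring_scope.

(** The idea is to read the set T as a configuration of spins: triangle k has
    spin -1 if its base is on the top line and +1 otherwise.  The sign of the
    edge e_k is then the product of the spins of its two triangles, so the
    exponent of M(Q_ij, q) in Z'_T telescopes to the product of the spins of
    the two distinct triangles i and j + 1 ([prod_tau]).

    Multiplying over T adds the exponents, since the MacMahon factors are
    units.  The exponent of M(Q_ij, q) in Z'_tot is thus the two-point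
    correlation of spins over all configurations with m spins -1 and n spins
    +1.  By symmetry it depends on m and n only, not on i and j, and this is
    homogeneity.  Sorting the configurations by the values of the two spins
    gives, with N = m + n - 2, the value C(N, n) + C(N, m) - 2 C(N, n - 1)
    ([sum_spin_corr]): both spins are -1, both are +1, or they differ.  Over
    the common denominator m! n! this is the closed formula for d
    ([spin_corr_formula]).

    It remains to see that the products Q_ij are indexed by distinct sets of
    edges, so that the double product over i <= j is a product over a
    collection of sets ([prod_intervals]). *)

(** * Spin correlations over sets of given size *)

Section SpinCorrelation.
Variable X : finType.
Implicit Types (A B T U : {set X}) (a b : X).

(** Complementation inside [B] turns the sets to be counted into the
    ([#|B| - k])-subsets of [B :\: A].  Counting the complements rather than
    the sets [T :\: A] keeps the formula valid when [k < #|A|]. *)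
Lemma card_draws_between A B k : A \subset B -> (k <= #|B|)%N ->
  #|[set T : {set X} | [&& A \subset T, T \subset B & #|T| == k]]| =
  'C(#|B| - #|A|, #|B| - k).
Proof.
move=> sAB kB.
rewrite -(cardsDS sAB) -cards_draws.
have compl_inj : {in [set S : {set X} | S \subset B :\: A & #|S| == (#|B| - k)%N] &,
    injective (fun S => B :\: S)}.
  move=> S1 S2; rewrite !inE !subsetD => /andP[/andP[s1 _] _] /andP[/andP[s2 _] _] e.
  have setDK (S : {set X}) : S \subset B -> B :\: (B :\: S) = S.
    by move=> sSB; rewrite setDDr setDv set0U (setIidPr sSB).
  by rewrite -(setDK S1) // e setDK.
rewrite -(card_in_imset compl_inj); congr #|pred_of_set _|; apply/setP => T.
apply/idP/imsetP; rewrite inE.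
  move=> /and3P[sAT sTB /eqP cT]; exists (B :\: T).
    by rewrite inE setDS //= cardsDS // cT.
  by rewrite setDDr setDv set0U (setIidPr sTB).
move=> [S]; rewrite inE subsetD => /andP[/andP[sSB dSA] /eqP cS] ->.
rewrite subsetD sAB disjoint_sym dSA subsetDl /= cardsDS // cS.
by rewrite subKn.
Qed.

Definition spin T a : int := (-1) ^+ (a \in T).

(** The product of two spins as a signed sum of the indicators of the four
    cases; each indicator then counts the sets between two bounds. *)
Lemma spinM_cases T a b : spin T a * spin T b =
  ((a \in T) && (b \in T))%:R + ((a \notin T) && (b \notin T))%:R
  - ((a \in T) && (b \notin T))%:R - ((b \in T) && (a \notin T))%:R.
Proof. by rewrite /spin; case: (a \in T); case: (b \in T). Qed.

Definition spin_corr (m n : nat) : int :=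
  'C(m + n - 2, n)%:R + 'C(m + n - 2, m)%:R - 'C(m + n - 2, n.-1)%:R *+ 2.

Lemma sum_indicator (S P : pred {set X}) :
  \sum_(T | S T) (P T)%:R = #|[set T | S T && P T]|%:R :> int.
Proof.
by rewrite -sum1dep_card natr_sum big_mkcondr; apply: eq_bigr => T _; case: (P T).
Qed.

Lemma card_draws_in_notin U a b m n : a \in U -> b \in U -> a != b ->
  #|U| = (m + n)%N -> (0 < n)%N ->
  #|[set T : {set X} | (T \subset U) && (#|T| == m) && ((a \in T) && (b \notin T))]|
  = 'C(m + n - 2, n.-1).
Proof.
move=> aU bU ab cU n0.
have cUb : #|U :\ b| = (m + n).-1 by have := cardsD1 b U; rewrite bU; lia.
have sa : [set a] \subset U :\ b by rewrite sub1set !inE ab.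
have := @card_draws_between [set a] (U :\ b) m sa.
rewrite cUb cards1 => H.
transitivity 'C((m + n).-1 - 1, (m + n).-1 - m); last by congr 'C(_, _); lia.
rewrite -H; last by lia.
congr #|pred_of_set _|; apply/setP => T; rewrite !inE sub1set subsetD1.
by case: (a \in T); case: (b \in T); case: (T \subset U); case: (#|T| == m).
Qed.

(** The right-hand side does not depend on [a] and [b]: this is what makes the
    total partition function homogeneous. *)
Lemma sum_spin_corr U a b m n : a \in U -> b \in U -> a != b ->
  #|U| = (m + n)%N -> (0 < n)%N ->
  \sum_(T : {set X} | (T \subset U) && (#|T| == m)) spin T a * spin T b
  = spin_corr m n.
Proof.
move=> aU bU ab cU n0.
under eq_bigr do rewrite spinM_cases.
rewrite !sumrB big_split /= !sum_indicator.
rewrite (card_draws_in_notin _ a b _ n) // (card_draws_in_notin _ b a _ n) 1?eq_sym //.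
have cab : #|[set a; b]| = 2%N by rewrite cards2 ab.
have sab : [set a; b] \subset U by rewrite subUset !sub1set aU bU.
have both : #|[set T : {set X} | (T \subset U) && (#|T| == m)
    && ((a \in T) && (b \in T))]| = 'C(m + n - 2, n).
  have := @card_draws_between [set a; b] U m sab.
  rewrite cU cab addKn leq_addr => <- //; congr #|pred_of_set _|; apply/setP => T.
  rewrite !inE subUset !sub1set.
  by case: (a \in T); case: (b \in T); case: (T \subset U); case: (#|T| == m).
have neither : #|[set T : {set X} | (T \subset U) && (#|T| == m)
    && ((a \notin T) && (b \notin T))]| = 'C(m + n - 2, m).
  rewrite -cU -cab -(cardsDS sab) -cards_draws; congr #|pred_of_set _|.
  apply/setP => T; rewrite !inE setDUr subsetI !subsetD1.
  by case: (a \in T); case: (b \in T); case: (T \subset U); case: (#|T| == m).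
by rewrite both neither /spin_corr mulr2n opprD addrA.
Qed.

End SpinCorrelation.

(** Clearing the denominator in the number of configurations whose two chosen
    spins are both -1 (or, with the roles of [k] and [l] exchanged, both +1).
    For [k <= 1] there are none, and the factor [k * k.-1] vanishes as well. *)
Lemma bin_sub2_fact k l : (0 < l)%N ->
  ('C(k + l - 2, l) * (k`! * l`!) = (k + l - 2)`! * (k * k.-1))%N.
Proof.
move=> l0; case: k => [|[|k]]; first by rewrite bin_small ?muln0; lia.
  by rewrite bin_small ?muln0; lia.
have -> : (k.+2 + l - 2 = k + l)%N by lia.
have := @bin_fact (k + l) l (leq_addl _ _); rewrite addnK => <-.
by rewrite !factS /=; lia.
Qed.

Lemma spin_corr_formula m n : (0 < m)%N -> (0 < n)%N ->
  (spin_corr m n)%:~R =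
    (m%:R ^+ 2 - m%:R + n%:R ^+ 2 - n%:R - 2%:R * m%:R * n%:R)
      * (m + n - 2)`!%:R / (m`!%:R * n`!%:R) :> rat.
Proof.
move=> m0 n0.
have fact_neq0 k : k`!%:R != 0 :> rat by rewrite pnatr_eq0 -lt0n fact_gt0.
have cast c x y e u : (c * (x * y) = e * u)%N ->
    c%:R * (x%:R * y%:R) = e%:R * u%:R :> rat.
  by move=> E; rewrite -!natrM E.
have Emn : ('C(m + n - 2, n.-1) * (m`! * n`!) = (m + n - 2)`! * (m * n))%N.
  case: m n m0 n0 {fact_neq0 cast} => [|m] [|n] // _ _.
  have -> : (m.+1 + n.+1 - 2 = m + n)%N by lia.
  have := @bin_fact (m + n) n (leq_addl _ _); rewrite addnK => <-.
  by rewrite !factS /=; lia.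
have predR k : (k * k.-1)%:R = k%:R ^+ 2 - k%:R :> rat.
  by case: k => [|k]; rewrite ?mul0n ?expr0n ?subr0 //= natrM -[k.+1]addn1 natrD; ring.
have := cast _ _ _ _ _ (bin_sub2_fact m n n0).
have := cast _ _ _ _ _ (bin_sub2_fact n m m0).
have := cast _ _ _ _ _ Emn.
rewrite [(n + m)%N]addnC !predR natrM => {}Emn En Em.
apply: (canRL (mulfK _)); first by rewrite mulf_neq0.
have -> : (spin_corr m n)%:~R = 'C(m + n - 2, n)%:R + 'C(m + n - 2, m)%:R
    - 'C(m + n - 2, n.-1)%:R *+ 2 :> rat.
  by rewrite /spin_corr rmorphB rmorphD /= [X in _ - X]rmorphMn /= !rmorph_nat.
rewrite [LHS]mulrBl [X in X - _]mulrDl [X in _ - X]mulrnAl Em Emn [m`!%:R * _]mulrC En.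
by ring.
Qed.

(** * Products over intervals *)

Definition itv_set M (i j : nat) : {set 'I_M.+1} :=
  [set k : 'I_M.+1 | i <= k <= j]%N.

Definition itv_ends M : {set 'I_M.+1 * 'I_M.+1} :=
  [set p : 'I_M.+1 * 'I_M.+1 | 0 < p.1 <= p.2]%N.

Definition itv_sets M : {set {set 'I_M.+1}} :=
  [set itv_set M p.1 p.2 | p : 'I_M.+1 * 'I_M.+1 in itv_ends M].

Lemma itv_set_inj M :
  {in itv_ends M &, injective (fun p : 'I_M.+1 * 'I_M.+1 => itv_set M p.1 p.2)}.
Proof.
move=> [i j] [i' j']; rewrite !inE /= => /andP[_ ij] /andP[_ ij'] /setP e.
have := e i; have := e j; have := e i'; have := e j'.
rewrite !inE !leqnn ij ij' /= => e1 e2 e3 e4.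
by congr pair; apply: val_inj => /=; lia.
Qed.

(** An interval determines its end points, so each factor on the right-hand
    side belongs to exactly one set of the collection. *)
Lemma prod_intervals (R : comPzSemiRingType) M N (F : {set 'I_M.+1} -> R) :
  N = M.+1 ->
  \prod_(A in itv_sets M) F A =
  \prod_(1 <= i < N) \prod_(i <= j < N) F (itv_set M i j).
Proof.
move=> ->; rewrite /itv_sets big_imset /=; last exact: itv_set_inj.
rewrite big_geq_mkord.
under [RHS]eq_bigr do rewrite big_geq_mkord.
by rewrite pair_big_dep; apply: eq_bigl => p; rewrite inE.
Qed.

Lemma prod_itv_set (R : comPzSemiRingType) M i j (F : nat -> R) : (j <= M)%N ->
  \prod_(k in itv_set M i j) F k = \prod_(i <= k < j.+1) F k.
Proof.
move=> jM; rewrite (@big_nat_widen _ _ _ i j.+1 M.+1) // big_geq_mkord.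
by apply: eq_bigl => k; rewrite inE ltnS andbC.
Qed.

(** * Integer powers of units *)

Section UnitPowers.
Variable R : comUnitRingType.

Lemma prod_exprz (I : Type) (r : seq I) (P : pred I) (e : I -> int) (x : R) :
  x \is a GRing.unit ->
  \prod_(i <- r | P i) x ^ e i = x ^ (\sum_(i <- r | P i) e i).
Proof.
by move=> ux; elim/big_rec2: _ => // i y z _ ->; rewrite exprzDr.
Qed.

Lemma exprz_prod (I : Type) (r : seq I) (P : pred I) (F : I -> R) (d : int) :
  (forall i, F i \is a GRing.unit) ->
  (\prod_(i <- r | P i) F i) ^ d = \prod_(i <- r | P i) F i ^ d.
Proof.
move=> uF; elim: r => [|i r IH]; first by rewrite !big_nil exp1rz.
rewrite !big_cons; case: (P i) => //; rewrite exprMz_comm ?IH //.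
- by apply: rpred_prod.
- exact: mulrC.
Qed.

End UnitPowers.

(** * The partition function *)

Lemma MacMahon_qvar_unit m n x : MacMahon x (qvar m n) \is a GRing.unit.
Proof.
apply: MacMahon_unit; rewrite /= eq_sym.
by rewrite mpoly.mnm1_eq0.
Qed.

Lemma tau_spin m n (T : {set 'I_(m + n).+1}) k :
  tau T k = spin _ T (inord k) * spin _ T (inord k.+1).
Proof. by rewrite /tau /spin; case: (_ \in T); case: (_ \in T). Qed.

(** The product telescopes: every spin strictly between the two ends occurs
    twice, hence squares to 1. *)
Lemma prod_tau m n (T : {set 'I_(m + n).+1}) i j : (i <= j)%N ->
  \prod_(i <= k < j.+1) tau T k = spin _ T (inord i) * spin _ T (inord j.+1).
Proof.
elim: j => [|j IH] ij.
  by move: ij; rewrite leqn0 => /eqP ->; rewrite big_nat1 tau_spin.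
have [ltij|leij] := ltnP i j.+1; last first.
  have -> : i = j.+1 by lia.
  by rewrite big_nat1 tau_spin.
rewrite big_nat_recr //= IH // tau_spin mulrA -(mulrA (spin _ T (inord i))).
by rewrite -expr2 sqrr_sign mulr1.
Qed.

Lemma sum_prod_tau m n i j : (0 < n)%N -> (0 < i <= j)%N -> (j < m + n)%N ->
  \sum_(T in triangulations m n) \prod_(i <= k < j.+1) tau T k = spin_corr m n.
Proof.
move=> n0 /andP[i0 ij] jN.
have vi : (inord i : 'I_(m + n).+1) = i :> nat by rewrite inordK //; lia.
have vj : (inord j.+1 : 'I_(m + n).+1) = j.+1 :> nat by rewrite inordK //; lia.
rewrite -(sum_spin_corr 'I_(m + n).+1 [set~ ord0] (inord i) (inord j.+1) m n) //.
- apply: eq_big => [T|T _]; last exact: prod_tau.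
  by rewrite inE -[T \subset _]setCS setCK sub1set inE.
- by rewrite !inE -val_eqE /= vi -lt0n.
- by rewrite !inE -val_eqE /= vj.
- by rewrite -val_eqE /= vi vj; lia.
- by rewrite cardsC1 card_ord.
Qed.

Lemma Ztot_MacMahon m n : (0 < n)%N ->
  Ztot (- qvar m n) =
    \prod_(1 <= i < m + n) \prod_(i <= j < m + n)
      MacMahon (Qprod m n i j) (qvar m n) ^ spin_corr m n.
Proof.
move=> n0; rewrite /Ztot /ZT opprK exchange_big /=.
apply: eq_big_nat => i /andP[i0 _]; rewrite exchange_big /=.
apply: eq_big_nat => j /andP[ij jN].
by rewrite prod_exprz ?MacMahon_qvar_unit // sum_prod_tau // i0.
Qed.

Theorem proposition5p4 (m n : nat) (hm : (0 < m)%N) (hmn : (m <= n)%N) :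
  exists d : int,
    [/\ d%:~R = ((m%:R ^+ 2 - m%:R + n%:R ^+ 2 - n%:R - 2%:R * m%:R * n%:R)
                  * (m + n - 2)`!%:R / (m`!%:R * n`!%:R)) :> rat,
        homogeneous_of_degree (Ztot (- qvar m n)) d &
        Ztot (- qvar m n) =
          \prod_(1 <= i < m + n) \prod_(i <= j < m + n)
            MacMahon (Qprod m n i j) (qvar m n) ^ d].
Proof.
have n0 : (0 < n)%N := leq_trans hm hmn.
have EN : (m + n)%N = (m + n).-1.+1 by lia.
exists (spin_corr m n); split.
- exact: spin_corr_formula.
- exists (itv_sets (m + n).-1).
    move=> A /imsetP[[i j]]; rewrite !inE /= => /andP[i0 _] ->.
    by rewrite inE /= leqNgt i0.
  rewrite Ztot_MacMahon // exprz_prod; last by move=> A; exact: MacMahon_qvar_unit.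
  rewrite (prod_intervals _ _ _ _ EN).
  apply: eq_big_nat => i _; apply: eq_big_nat => j /andP[_ jN].
  by rewrite prod_itv_set //; lia.
- exact: Ztot_MacMahon.
Qed.
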